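(* Let $M$ be a smooth $n$-manifold and let $f\colon M\to\mathbb{R}$ be a CS function on $M$, given as a continuous selection of smooth functions $f_1,\ldots,f_m\colon M\to\mathbb{R}$. For $0\le i\le m$ define $$X^{i}=\left\{x\in M\,:\, |I_f(x)|\ge m-i+1\right\}.$$ Then the sequence $$\emptyset=X^{0}\subset X^{1}\subset\ldots\subset X^{m-1}\subset X^{m}=M$$ defines a stratification of $M$; that is, it makes $M$ a filtered space which satisfies the frontier condition.
   Context: Let $M$ be a smooth manifold and $f_1,\ldots,f_m\colon M\to\mathbb{R}$ smooth functions. A continuous function $f\colon M\to\mathbb{R}$ is a continuous selection of $f_1,\ldots,f_m$, written $f\in CS(f_1,\ldots,f_m)$, if (1) the active index set $I_f(x)=\{i\in\{1,\ldots,m\} : f(x)=f_i(x)\}$ is nonempty for every $x\in M$, and (2) for every $i\in\{1,\ldots,m\}$ there is $x\in M$ with $i\in I_f(x)$. The set of essentially active indices at $x_0$ is $\widehat I_f(x_0)=\{i : x_0\in \mathrm{cl}(\mathrm{int}\{x : f(x)=f_i(x)\})\}$. A CS function on $M$ is a function $f\colon M\to\mathbb{R}$ for which there are smooth functions $f_1,\ldots,f_m\colon M\to\mathbb{R}$ such that (1) $f\in CS(f_1,\ldots,f_m)$; (2) $I_f(x)=\widehat I_f(x)$ for every $x\in M$; (3) at every $x\in M$ the gradients of the active functions $\{f_j : j\in I_f(x)\}$ (taken e.g. in local coordinates) are affinely independent. A filtered space is a Hausdorff topological space $X$ equipped with a sequence of closed subspaces $\emptyset=X^0\subset X^1\subset\ldots\subset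 X^{n-1}\subset X^n=X$ for some integer $n\ge 0$ (inclusions need not be proper). The strata of formal dimension $i$ are the connected components of $X_i=X^i\setminus X^{i-1}$. The filtered space satisfies the frontier condition if for any two strata $S,T$: if $S\cap \mathrm{cl}(T)\ne\emptyset$, then $S\subset \mathrm{cl}(T)$. A stratified space is a filtered space that satisfies the frontier condition. *)

(* Defs.v *)
From HB Require Import structures.
From mathcomp Require Import all_boot all_order all_algebra.
From mathcomp Require Import all_classical all_reals all_analysis.
Import Order.TTheory GRing.Theory Num.Theory.
Import numFieldNormedType.Exports.

Set Implicit Arguments.
Unset Strict Implicit.
Unset Printing Implicit Defensive.

Local Open Scope classical_set_scope.
Local Open Scope ring_scope.

Section EuclideanSmoothness.
Context {R : realType} {n : nat}.
Implicit Types (U : set 'rV[R]_n) (g : 'rV[R]_n -> R).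

Definition partial (i : 'I_n) g : 'rV[R]_n -> R := 'D_(delta_mx ord0 i) g.

(* C^k on U: the iterated partial derivatives of order <= k exist and are
   continuous at the points of U. It is used for open U only, so that the
   values of g outside U are irrelevant. *)
Fixpoint Ck_on (k : nat) U g : Prop :=
  {in U, continuous g} /\
  if k is k'.+1 then
    forall i : 'I_n,
      {in U, forall y, derivable g y (delta_mx ord0 i)} /\
      Ck_on k' U (partial i g)
  else True.

Definition smooth_on U g : Prop := forall k, Ck_on k U g.

End EuclideanSmoothness.

(* A homeomorphism between an open subset of M and an open subset of R^n. Both
   directions are total functions, of which only the restrictions to chart_dom
   and chart_cod matter. *)
Record chart (R : realType) (n : nat) (M : topologicalType) := Chart {
  chart_dom : set M ;
  chart_cod : set 'rV[R]_n ;
  chart_map :> M -> 'rV[R]_n ;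
  chart_inv : 'rV[R]_n -> M ;
  chart_dom_open : open chart_dom ;
  chart_cod_open : open chart_cod ;
  chart_map_cod : forall x, chart_dom x -> chart_cod (chart_map x) ;
  chart_inv_dom : forall y, chart_cod y -> chart_dom (chart_inv y) ;
  chart_mapK : {in chart_dom, cancel chart_map chart_inv} ;
  chart_invK : {in chart_cod, cancel chart_inv chart_map} ;
  chart_map_continuous : {in chart_dom, continuous chart_map} ;
  chart_inv_continuous : {in chart_cod, continuous chart_inv} }.

Definition smoothly_compatible (R : realType) (n : nat) (M : topologicalType)
    (c d : chart R n M) : Prop :=
  forall i : 'I_n,
    smooth_on [set y | chart_cod c y /\ chart_dom d (chart_inv c y)]
      (fun y => d (chart_inv c y) ord0 i).

(* The smooth structure is given by an atlas, which need not be maximal. *)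
Record smoothManifold (R : realType) (n : nat) := SmoothManifold {
  manifold_sort :> topologicalType ;
  manifold_hausdorff : hausdorff_space manifold_sort ;
  manifold_second_countable : @second_countable manifold_sort ;
  manifold_atlas : set (chart R n manifold_sort) ;
  manifold_atlas_cover :
    forall x, exists2 c, manifold_atlas c & chart_dom c x ;
  manifold_atlas_compatible :
    forall c d, manifold_atlas c -> manifold_atlas d -> smoothly_compatible c d
}.

Section SmoothFunctions.
Context {R : realType} {n : nat} {M : smoothManifold R n}.

Definition smooth (g : M -> R) : Prop :=
  forall c, manifold_atlas c -> smooth_on (chart_cod c) (g \o chart_inv c).

Definition gradient (c : chart R n M) (g : M -> R) (x : M) : 'rV[R]_n :=
  \row_i partial i (g \o chart_inv c) (c x).

End SmoothFunctions.

(* Affine independence of the indexed family (v i), i in A: in particular,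
   repeated vectors are dependent. *)
Definition affinely_independent (R : realType) (V : lmodType R) (I : finType)
    (A : {set I}) (v : I -> V) : Prop :=
  forall a : I -> R,
    \sum_(i in A) a i = 0 -> \sum_(i in A) a i *: v i = 0 ->
    {in A, forall i, a i = 0}.

Section ContinuousSelections.
Context {R : realType} {n : nat} {M : smoothManifold R n} {m : nat}.
Variables (f : M -> R) (fs : 'I_m -> M -> R).

Definition active_set (x : M) : {set 'I_m} := [set i | f x == fs i x]%SET.

Definition ess_active_set (x : M) : {set 'I_m} :=
  [set i | `[< closure (interior [set y | f y = fs i y]) x >] ]%SET.

Definition continuous_selection : Prop :=
  [/\ continuous f,
      forall x, active_set x != finset.set0
    & forall i, exists x, i \in active_set x].

(* By the chain rule, affine independence of the gradients at x does not depend
   on the chart around x in which they are computed. *)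
Definition CS_presentation : Prop :=
  [/\ forall i, smooth (fs i),
      continuous_selection,
      forall x, active_set x = ess_active_set x
    & forall x, exists c : chart R n M,
        [/\ manifold_atlas c, chart_dom c x
          & affinely_independent (active_set x)
              (fun j => gradient c (fs j) x)]].

End ContinuousSelections.

Definition CS_function (R : realType) (n : nat) (M : smoothManifold R n)
    (f : M -> R) : Prop :=
  exists (m : nat) (fs : 'I_m -> M -> R), CS_presentation f fs.

(* A filtration X^0, ..., X^N of a space T is a sequence X : nat -> set T, whose
   terms of index > N are irrelevant. *)
Section Stratifications.
Context {T : topologicalType}.
Variables (N : nat) (X : nat -> set T).

Definition filtered_space : Prop :=
  [/\ hausdorff_space T,
      forall i, (i <= N)%N -> closed (X i),
      X 0%N = set0,
      X N = [set: T]
    & forall i, (i < N)%N -> X i `<=` X i.+1].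

(* There is no stratum of formal dimension 0 since X^0 is empty. *)
Definition stratum (i : nat) (S : set T) : Prop :=
  (0 < i <= N)%N /\
  exists2 x, (X i `\` X i.-1) x & S = connected_component (X i `\` X i.-1) x.

Definition frontier_condition : Prop :=
  forall (i j : nat) (S S' : set T), stratum i S -> stratum j S' ->
    S `&` closure S' !=set0 -> S `<=` closure S'.

Definition stratified_space : Prop := filtered_space /\ frontier_condition.

End Stratifications.

Definition activity_filtration (R : realType) (n : nat) (M : smoothManifold R n)
    (m : nat) (f : M -> R) (fs : 'I_m -> M -> R) (i : nat) : set M :=
  [set x | (m - i + 1 <= #|active_set f fs x|)%N].

(* Main.v *)
Require Import Defs.
From HB Require Import structures.
From mathcomp Require Import all_boot all_order all_algebra.
From mathcomp Require Import all_classical all_reals all_analysis.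
From mathcomp Require Import lra zify.
Import Order.TTheory GRing.Theory Num.Theory.
Import numFieldNormedType.Exports.

Set Implicit Arguments.
Unset Strict Implicit.
Unset Printing Implicit Defensive.

Local Open Scope classical_set_scope.
Local Open Scope ring_scope.

(* Near a point x0 with active set I, only functions indexed by I are active,
   and for a fixed i0 in I the differences fs i - fs i0, i in I \ i0, form a
   submersion. By the inverse function theorem (a contraction argument), any p
   close to x0 can be joined to any x close to x0 with active set I by a path
   along which these differences shrink linearly to 0. Before the endpoint no
   difference fs i - fs j changes between zero and nonzero, so by continuity of
   f the active set is constant there: x lies in the closure of the stratum of
   p. Hence S meets cl S' in an open subset of S; it is also closed in S, and S
   is connected. *)

(** * Norm bounds on row vectors and strict differentiability of C^1 functions *)

Section StrictDifferentiability.
Context {R : realType}.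

Lemma row_norm_coord n (v : 'rV[R]_n) i : `|v ord0 i| <= `|v|.
Proof.
rewrite [leRHS]/Num.norm /= mx_normrE.
exact: (le_bigmax 0 (fun ij : 'I_1 * 'I_n => `|v ij.1 ij.2|) (ord0, i)).
Qed.

Lemma row_norm_lt n (v : 'rV[R]_n) (r : R) :
  0 < r -> (forall i, `|v ord0 i| < r) -> `|v| < r.
Proof.
move=> r0 vr; rewrite [ltLHS]/Num.norm /= mx_normrE.
by apply/bigmax_ltP; split=> // -[i j] _ /=; rewrite ord1.
Qed.

Lemma row_norm_le n (v : 'rV[R]_n) (r : R) :
  0 <= r -> (forall i, `|v ord0 i| <= r) -> `|v| <= r.
Proof.
move=> r0 vr; rewrite [leLHS]/Num.norm /= mx_normrE.
by apply/bigmax_leP; split=> // -[i j] _ /=; rewrite ord1.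
Qed.

Lemma mulmx_row_norm_le n q (B : 'M[R]_(q, n)) :
  exists2 K, 0 < K & forall v : 'rV[R]_q, `|v *m B| <= K * `|v|.
Proof.
(* The added 1 keeps the constant positive, hence invertible, even when [B] is zero. *)
exists (1 + \sum_k \sum_j `|B k j|).
  by rewrite ltr_pwDl// sumr_ge0// => k _; rewrite sumr_ge0.
move=> v; apply: row_norm_le => [|j].
  by rewrite mulr_ge0// addr_ge0// sumr_ge0// => k _; rewrite sumr_ge0.
rewrite mxE (le_trans (ler_norm_sum _ _ _))//.
rewrite mulrDl mul1r ler_wpDl// mulr_suml ler_sum// => k _.
rewrite normrM mulrC ler_pM ?row_norm_coord//.
by rewrite (bigD1 j)//= lerDl sumr_ge0.
Qed.

(** Mean value theorem for [s |-> g (x + s *: v) - s * a]. The two conditions on [s] say that it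
    lies between [0] and [t], whatever the sign of [t]. *)
Lemma line_increment_le (V : normedModType R) (g : V -> R) (x v : V)
    (a eps t : R) :
  (forall s : R, `|s| <= `|t| -> 0 <= s * t -> derivable g (x + s *: v) v) ->
  (forall s : R, `|s| <= `|t| -> 0 <= s * t ->
    `|'D_v g (x + s *: v) - a| <= eps) ->
  `|g (x + t *: v) - g x - t * a| <= eps * `|t|.
Proof.
move=> dg ga; pose h s := g (x + s *: v) - s * a.
pose dh' s := 'D_v g (x + s *: v) - a.
have dh s : `|s| <= `|t| -> 0 <= s * t ->
    is_derive s (1 : R) h (dh' s).
  move=> st1 st2; apply: is_deriveB; last first.
    rewrite (_ : (fun s => s * a) = a \*: id).
      by apply: is_derive_eq; exact: mulr1.
    by apply/funext => k /=; rewrite mulrC.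
  have E : (fun k : R => k^-1 *:
      (((fun s => g (x + s *: v)) \o shift s) (k *: (1 : R)) - g (x + s *: v)))
      = (fun k => k^-1 *: ((g \o shift (x + s *: v)) (k *: v) - g (x + s *: v))).
    apply/funext => k /=; congr (_ *: (g _ - _)).
    by rewrite [k *: 1]mulr1 scalerDl addrCA addrA addrC.
  apply: DeriveDef; first by rewrite /derivable E; exact: dg.
  by rewrite /derive E.
have hc (p q : R) : (forall s, s \in `[p, q] -> `|s| <= `|t| /\ 0 <= s * t) ->
    {within `[p, q], continuous h}.
  move=> pq; apply: derivable_within_continuous => s /pq[s1 s2].
  by have /@ex_derive := dh _ s1 s2.
have -> : g (x + t *: v) - g x - t * a = h t - h 0.
  by rewrite /h scale0r addr0 mul0r subr0 addrAC.
have [t0|t0] := leP 0 t.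
  have I s : s \in `[0, t] -> `|s| <= `|t| /\ 0 <= s * t.
    by rewrite in_itv /= => /andP[s0 st]; rewrite !ger0_norm// mulr_ge0.
  have [|s /I[s1 s2] ->] := MVT_segment (df := dh') t0 _ (hc _ _ I).
    move=> s; rewrite in_itv /= => /andP[s0 st].
    have /I[] : s \in `[0, t] by rewrite in_itv/= !ltW.
    exact: dh.
  by rewrite subr0 normrM ler_wpM2r// ga.
have I s : s \in `[t, 0] -> `|s| <= `|t| /\ 0 <= s * t.
  rewrite in_itv /= => /andP[st s0]; split; last by rewrite mulr_le0// ltW.
  by rewrite !ler0_norm ?lerN2// ltW.
have [|s /I[s1 s2]] := MVT_segment (df := dh') (ltW t0) _ (hc _ _ I).
  move=> s; rewrite in_itv /= => /andP[s0 st].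
  have /I[] : s \in `[t, 0] by rewrite in_itv/= !ltW.
  exact: dh.
by rewrite distrC => ->; rewrite sub0r normrM normrN ler_wpM2r// ga.
Qed.

(** Passing from [x] to [y] one coordinate at a time leaves [n] increments along the axes, each
    controlled by a partial derivative close to its value at [c]. Both points vary: this is what
    later yields a Lipschitz bound. *)
Lemma C1_strict_differential n (U : set 'rV[R]_n) (g : 'rV[R]_n -> R)
    (c : 'rV[R]_n) (eps : R) :
  open U -> U c -> Ck_on 1 U g -> 0 < eps ->
  \forall r \near 0^'+, forall x y, `|x - c| < r -> `|y - c| < r ->
    `|g y - g x - \sum_i (y - x) ord0 i * partial i g c| <= eps * `|y - x|.
Proof.
move=> oU Uc [_ C1] eps0.
(* Each of the [n] coordinates gets a share of [eps]; [n.+1] keeps the share positive when [n] is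
   0. *)
pose e := eps / n.+1%:R.
have e0 : 0 < e by rewrite divr_gt0.
have : \forall z \near c, U z /\
    forall i, `|partial i g z - partial i g c| <= e.
  near=> z; split; first by near: z; exact: open_nbhs_nbhs.
  near: z; apply: filter_forall => i.
  have [_ [+ _]] := C1 i => /(_ c (mem_set Uc)) /cvgrPdist_le /(_ _ e0).
  by apply: filterS => z; rewrite distrC.
move=> /nbhs_ballP[d /= d0 dP]; near=> r => x y xr yr.
have {}dP z : `|z - c| < r -> U z /\
    forall i, `|partial i g z - partial i g c| <= e.
  move=> zr; apply: dP; rewrite -ball_normE /= distrC (lt_le_trans zr)//.
  by near: r; exact: nbhs_right_le.
have r0 : 0 < r by [].
(* The intermediate points: the first [k] coordinates come from [y], the others from [x]. *)
pose z (k : nat) : 'rV[R]_n := \row_i (if (i < k)%N then y ord0 i else x ord0 i).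
have -> : g y = g (z n).
  by congr g; apply/rowP => i; rewrite mxE ltn_ord.
have -> : g x = g (z 0%N) by congr g; apply/rowP => i; rewrite mxE.
rewrite -(telescope_sumr (fun k => g (z k)))// big_mkord -sumrB.
rewrite (le_trans (ler_norm_sum _ _ _))//.
rewrite (@le_trans _ _ (\sum_(i < n) e * `|y - x|))//; last first.
  rewrite sumr_const card_ord -mulr_natr mulrAC ler_wpM2r//.
  by rewrite /e -mulrA ler_piMr ?(ltW eps0)// ler_pdivrMl// mulr1 ler_nat.
apply: ler_sum => i _.
have zS s : z i + s *: delta_mx ord0 i = \row_j
    (if (j < i)%N then y ord0 j else if j == i then x ord0 i + s else x ord0 j).
  apply/rowP => j; rewrite !mxE eqxx /=; have [->|ji] := eqVneq j i.
    by rewrite ltnn mulr1.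
  by rewrite mulr0 addr0.
have -> : z i.+1 = z i + (y - x) ord0 i *: delta_mx ord0 i.
  rewrite zS; apply/rowP => j; rewrite !mxE ltnS leq_eqVlt.
  have [->|ji] := eqVneq j i; first by rewrite eqxx ltnn addrCA subrr addr0.
  by rewrite (inj_eq val_inj) (negbTE ji).
(* Each coordinate lies between those of [x] and [y], so the point stays in the ball of the maximum
   norm. *)
have zr s : `|s| <= `|(y - x) ord0 i| -> 0 <= s * (y - x) ord0 i ->
    `|z i + s *: delta_mx ord0 i - c| < r.
  move=> s1 s2; rewrite zS; apply: row_norm_lt => // j; rewrite !mxE.
  have cx k := le_lt_trans (row_norm_coord (x - c) k) xr.
  have cy k := le_lt_trans (row_norm_coord (y - c) k) yr.
  have := cx j; have := cy j; rewrite !mxE; case: ifP => // _.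
  case: eqP => // ->; move: s1 s2; rewrite !mxE !ltr_norml => s1 s2.
  move=> /andP[cy1 cy2] /andP[cx1 cx2].
  have [d1|d1] := leP 0 (y ord0 i - x ord0 i).
    have [s0|s0] := leP 0 s; first by move: s1; rewrite (ger0_norm s0) (ger0_norm d1); lra.
    by move: s1; rewrite (ger0_norm d1) (ltr0_norm s0); nra.
  have [s0|s0] := leP s 0; first by move: s1; rewrite (ler0_norm s0) (ltr0_norm d1); lra.
  by move: s1; rewrite (ltr0_norm d1) (gtr0_norm s0); nra.
rewrite (le_trans (line_increment_le (eps := e) _ _)) //.
- move=> s s1 s2; have [Uz _] := dP _ (zr _ s1 s2).
  by have [+ _] := C1 i; apply; exact: mem_set.
- by move=> s s1 s2; have [_ ] := dP _ (zr _ s1 s2); apply.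
- by rewrite ler_wpM2l ?(ltW e0)// row_norm_coord.
Unshelve. all: by end_near. Qed.

End StrictDifferentiability.

(** * Inverting a Lipschitz perturbation of the identity *)

Section PerturbationOfIdentity.
Context {R : realType} {X : completeNormedModType R}.
Variables (Phi : X -> X) (c : X) (r : R).
Hypotheses (r0 : 0 < r)
  (Phi_lip : forall x y, `|x - c| <= r -> `|y - c| <= r ->
    `|(Phi x - x) - (Phi y - y)| <= 2^-1 * `|x - y|).

(** The perturbation absorbs at most half of [x - y]. Hence [Phi] is injective on the ball and its
    inverse is 2-Lipschitz. *)
Lemma near_identity_expansive x y : `|x - c| <= r -> `|y - c| <= r ->
  `|x - y| <= 2 * `|Phi x - Phi y|.
Proof.
move=> xr yr; have := Phi_lip xr yr.
have -> : Phi x - x - (Phi y - y) = (Phi x - Phi y) - (x - y).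
  by rewrite !opprD !opprK addrACA.
have := ler_distD (Phi x - Phi y) (x - y) 0.
by rewrite subr0 [`|x - y - _|]distrC subr0; lra.
Qed.

(** A preimage of [u] is a fixed point of [x |-> u - (Phi x - x)], a contraction of ratio 1/2. It
    preserves the closed ball, as [r / 2 + r / 2 = r]. *)
Lemma near_identity_surj u : `|u - Phi c| <= r / 2 ->
  exists2 x, `|x - c| <= r & Phi x = u.
Proof.
move=> ur; pose B := [set x : X | `|x - c| <= r].
have BE : B = closed_ball_ Num.norm c r.
  by apply/seteqP; split=> x; rewrite /B /closed_ball_ /= distrC.
pose F x := u - (Phi x - x).
have FB : set_fun B B F.
  move=> x Bx; rewrite /B/= /F.
  have -> : u - (Phi x - x) - c = (u - Phi c) - ((Phi x - x) - (Phi c - c)).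
    by rewrite [in RHS]opprB [in RHS]addrA subrKA addrAC.
  rewrite (le_trans (ler_normB _ _))//.
  have := Phi_lip Bx (y := c); rewrite subrr normr0 => /(_ (ltW r0)).
  by move: Bx; rewrite /B/=; lra.
have [|||x Bx xE] := @banach_fixed_point R X B (mkfun FB).
- exists (2^-1)%:nng; split => /=; first by rewrite invf_lt1// ltr1n.
  move=> [x y] [/= Bx By]; rewrite /F opprB addrC addrA subrK distrC.
  exact: Phi_lip.
- by rewrite BE; exact: closed_closed_ball_.
- by exists c; rewrite /B/= subrr normr0 ltW.
exists x => //; move: xE; rewrite /= /F => xE.
by rewrite -[LHS](subrK x) addrC {1}xE subrK.
Qed.

End PerturbationOfIdentity.

(** Makes row vectors a complete normed module, so that the preceding fixed point argument applies
    to them. *)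
HB.instance Definition _ (R : realType) (n : nat) :=
  Uniform_isComplete.Build 'rV[R]_n (@cauchy_cvg 'rV[R]_n).

(** * Local straightening of a submersion *)

Section StraightPaths.
Context {R : realType}.

(* In the coordinate [Phi x = x + (H x - x A) B], where [A] is the differential
   of [H] at [c] and [B A = 1], the map [H] is the linear map [u |-> u A]: the
   paths are the segments in this coordinate. *)
Lemma submersion_straight_path n q (U : set 'rV[R]_n)
    (G : 'I_q -> 'rV[R]_n -> R) (c : 'rV[R]_n) :
  open U -> U c -> (forall j, Ck_on 1 U (G j)) ->
  (forall a : 'rV[R]_q,
    (forall i, \sum_j a ord0 j * partial i (G j) c = 0) -> a = 0) ->
  exists2 W, nbhs c W & forall x y, W x -> W y ->
    exists g : R -> 'rV[R]_n,
      [/\ continuous g, forall s, U (g s), g 0 = x, g 1 = y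
        & forall j s, 0 <= s <= 1 ->
            G j (g s) = (1 - s) * G j x + s * G j y].
Proof.
move=> oU Uc C1G freeG.
pose A := \matrix_(i < n, j < q) partial i (G j) c.
(* Independence of the differentials means that the rows of [A^T] are free, whence a right inverse
   of [A^T]. *)
have [C AC] : exists C, A^T *m C = 1%:M.
  apply/row_freeP/inj_row_free => v vA; apply: freeG => i.
  have := congr1 (fun w : 'rV_n => w ord0 i) vA; rewrite !mxE => vAi.
  by rewrite -[RHS]vAi; apply: eq_bigr => j _; rewrite !mxE.
pose B := C^T.
have BA : B *m A = 1%:M.
  by apply: trmx_inj; rewrite trmx_mul trmxK AC trmx1.
pose H x := \row_j G j x.
pose Phi x := x + (H x - x *m A) *m B.
have PhiB x : Phi x - x = (H x - x *m A) *m B.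
  by rewrite /Phi addrAC subrr add0r.
have PhiA x : Phi x *m A = H x.
  by rewrite mulmxDl -mulmxA BA mulmx1 addrC subrK.
have [K K0 KB] := mulmx_row_norm_le B.
have [r /= r0 [rU Phi_lip]] : exists2 r, 0 < r &
    (forall x, `|x - c| <= r -> U x) /\
    forall x y, `|x - c| <= r -> `|y - c| <= r ->
      `|(Phi x - x) - (Phi y - y)| <= 2^-1 * `|x - y|.
  (* Multiplication by [B] costs a factor [K], so this error bound on [H] makes [Phi - id] Lipschitz
     with constant 1/2. *)
  have e0 : 0 < (2 * K)^-1 by rewrite invr_gt0 mulr_gt0.
  have G1 : \forall r \near (0 : R)^'+, forall j x y,
      `|x - c| < r -> `|y - c| < r ->
      `|G j y - G j x - \sum_i (y - x) ord0 i * partial i (G j) c|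
        <= (2 * K)^-1 * `|y - x|.
    apply: filter_forall => j.
    by apply: filterS (C1_strict_differential oU Uc (C1G j) e0) => r.
  have /nbhs_ballP[d /= d0 dU] : nbhs c U by exact: open_nbhs_nbhs.
  near (0 : R)^'+ => r.
  have r0 : 0 < r by [].
  have r2r x : `|x - c| <= r / 2 -> `|x - c| < r by lra.
  exists (r / 2); first by rewrite divr_gt0.
  split=> [x /r2r xr|x y /r2r xr /r2r yr].
    apply: dU; rewrite -ball_normE /= distrC (lt_le_trans xr)//.
    by near: r; exact: nbhs_right_le.
  have -> : Phi x - x - (Phi y - y) = (H x - H y - (x - y) *m A) *m B.
    rewrite !PhiB -mulmxBl; congr (_ *m B).
    by rewrite mulmxBl !opprD !opprK addrACA.
  apply: le_trans (KB _) _; rewrite -ler_pdivlMl// mulrA -invfM mulrC.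
  rewrite mulrC [K * 2]mulrC; apply: row_norm_le => [|j].
    by rewrite mulr_ge0 ?(ltW e0).
  rewrite !mxE; under eq_bigr do rewrite [A _ _]mxE.
  have Gr : forall j x y, `|x - c| < r -> `|y - c| < r ->
      `|G j y - G j x - \sum_i (y - x) ord0 i * partial i (G j) c|
        <= (2 * K)^-1 * `|y - x| by near: r.
  exact: Gr.
(* [Phi] is 3/2-Lipschitz on the ball, so radius [r / 3] lands within [r / 2] of [Phi c], where
   preimages exist. *)
have PhiW x : `|x - c| <= r / 3 -> `|Phi x - Phi c| <= r / 2.
  move=> xr; have := Phi_lip x c; rewrite subrr normr0 (ltW r0).
  have -> : Phi x - x - (Phi c - c) = (Phi x - Phi c) - (x - c).
    by rewrite !opprD !opprK addrACA.
  have := ler_normD (Phi x - Phi c - (x - c)) (x - c).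
  rewrite subrK => h1 /(_ _ isT) h2; have {h2} := h2; move: h1 xr r0; lra.
exists [set x | `|x - c| <= r / 3].
  apply/nbhs_ballP; exists (r / 3); rewrite /= ?divr_gt0// => x.
  by rewrite -ball_normE /= distrC => /ltW.
move=> x y /= xr yr.
(* The retraction of the line onto [[0, 1]]: it makes the path continuous on all of [R] without
   leaving [U]. *)
pose clamp (s : R) : R := (1 + `|s| - `|s - 1|) / 2.
have clampP s : 0 <= clamp s <= 1.
  have := ler_distD 0 s 1; have := ler_distD s 0 1; have := ler_distD 1 s 0.
  rewrite !subr0 !sub0r !normrN normr1 /clamp => ? ? ?.
  by apply/andP; split; lra.
have clampE s : 0 <= s <= 1 -> clamp s = s.
  by move=> /andP[s0 s1]; rewrite /clamp ger0_norm// ler0_norm; lra.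
have segP a : 0 <= a <= 1 ->
    `|(1 - a) *: Phi x + a *: Phi y - Phi c| <= r / 2.
  move=> /andP[a0 a1].
  have -> : (1 - a) *: Phi x + a *: Phi y - Phi c =
      (1 - a) *: (Phi x - Phi c) + a *: (Phi y - Phi c).
    by rewrite !scalerBr addrACA -opprD -scalerDl subrK scale1r.
  have -> : r / 2 = (1 - a) * (r / 2) + a * (r / 2).
    by rewrite -mulrDl subrK mul1r.
  have a1' : 0 <= 1 - a by rewrite subr_ge0.
  rewrite (le_trans (ler_normD _ _))// !normrZ (ger0_norm a0) (ger0_norm a1').
  by rewrite lerD// ler_wpM2l// PhiW.
pose u s := (1 - clamp s) *: Phi x + clamp s *: Phi y.
have /choice[g gP] s : exists z, `|z - c| <= r /\ Phi z = u s.
  suff /(near_identity_surj r0 Phi_lip)[z] : `|u s - Phi c| <= r / 2.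
    by exists z.
  exact/segP/clampP.
(* The chosen preimages inherit continuity from [u] through this bound. *)
have expand s t := near_identity_expansive Phi_lip (gP s).1 (gP t).1.
have gE s z : `|z - c| <= r / 3 -> u s = Phi z -> g s = z.
  move=> zr uz; apply/eqP; rewrite -subr_eq0 -normr_le0.
  have zr' : `|z - c| <= r by move: r0; lra.
  have := near_identity_expansive Phi_lip (gP s).1 zr'.
  by rewrite (gP s).2 uz subrr normr0 mulr0.
have u0 : u 0 = Phi x by rewrite /u clampE ?lexx ?ler01// subr0 scale1r scale0r addr0.
have u1 : u 1 = Phi y by rewrite /u clampE ?lexx ?ler01// subrr scale1r scale0r add0r.
exists g; split.
- have clampc : continuous clamp.
    move=> s; apply: cvgMr_tmp; apply: cvgB.
      by apply: cvgD; [exact: cvg_cst|exact: cvg_norm].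
    by apply: cvg_norm; apply: cvgB => //; exact: cvg_cst.
  have uc : continuous u.
    move=> s; apply: cvgD; apply: cvgZl; last exact: clampc.
    by apply: cvgB; [exact: cvg_cst|exact: clampc].
  move=> s; apply/cvgrPdist_lt => e e0.
  have /cvgrPdist_lt /(_ (e / 2)) := uc s.
  rewrite divr_gt0// => /(_ isT); apply: filterS => t.
  by have := expand s t; rewrite !(gP _).2; lra.
- by move=> s; apply: rU; have [] := gP s.
- exact: gE.
- exact: gE.
- move=> j s /clampE sE.
  have HE z k : G k z = (Phi z *m A) ord0 k by rewrite PhiA mxE.
  by rewrite !HE (gP s).2 /u sE mulmxDl -!scalemxAl !mxE.
Unshelve. all: by end_near. Qed.

End StraightPaths.

(** * Restrictions and differences of C^1 functions *)

Section C1Calculus.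
Context {R : realType} {n : nat}.
Implicit Types (U : set 'rV[R]_n) (g h : 'rV[R]_n -> R).

Lemma C1_on_subset U V g : U `<=` V -> Ck_on 1 V g -> Ck_on 1 U g.
Proof.
move=> UV [cg dg]; split=> [y /set_mem/UV/mem_set/cg //|i].
have [dgi [cgi _]] := dg i.
by do !split=> //; move=> y /set_mem/UV/mem_set; [exact: dgi|exact: cgi].
Qed.

Lemma C1_onB U g h : open U -> Ck_on 1 U g -> Ck_on 1 U h ->
  Ck_on 1 U (fun y => g y - h y).
Proof.
move=> oU [cg dg] [ch dh]; split=> [y Uy|i].
  exact: cvgB (cg _ Uy) (ch _ Uy).
have [dgi [cgi _]] := dg i; have [dhi [chi _]] := dh i.
split=> [y Uy|]; first exact: derivableB (dgi _ Uy) (dhi _ Uy).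
split=> [y Uy|//].
(* Since [U] is open, this identity holds near each of its points, so continuity carries over to the
   partial derivative of the difference. *)
have Dgh z : U z ->
    partial i (fun y => g y - h y) z = partial i g z - partial i h z.
  by move=> /mem_set Uz; exact: deriveB (dgi _ Uz) (dhi _ Uz).
rewrite /continuous_at Dgh; last exact: set_mem.
have /filterS2 : nbhs y U by apply: open_nbhs_nbhs; split=> //; exact: set_mem.
move=> UF P /(cvgB (cgi _ Uy) (chi _ Uy)); apply: UF => z Uz.
by rewrite /preimage /= (Dgh _ Uz).
Qed.

End C1Calculus.

(** * Semicontinuity and local constancy of the active set *)

Section ActiveSets.
Context {R : realType} {n : nat} {M : smoothManifold R n} {m : nat}.
Variables (f : M -> R) (fs : 'I_m -> M -> R).
Local Notation active := (active_set f fs).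

Lemma active_setP x i : reflect (f x = fs i x) (i \in active x).
Proof. by rewrite inE; exact: eqP. Qed.

Lemma smooth_continuous (g : M -> R) : smooth g -> continuous g.
Proof.
move=> sg x; have [c cA cx] := manifold_atlas_cover x.
have [gc _] := sg c cA 0%N; have cc := chart_map_continuous (mem_set cx).
have gcx := gc _ (mem_set (chart_map_cod cx)).
move=> P Pgx.
have : nbhs x (c @^-1` ((g \o chart_inv c) @^-1` P)).
  by apply: cc; apply: gcx; rewrite /= chart_mapK ?mem_set.
have : nbhs x (chart_dom c).
  by apply: open_nbhs_nbhs; split=> //; exact: chart_dom_open.
by apply: filterS2 => z cz; rewrite /= chart_mapK ?mem_set.
Qed.

Hypotheses (cf : continuous f) (cfs : forall i, continuous (fs i)).

Lemma closed_active i : closed [set x | f x = fs i x].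
Proof.
rewrite (_ : [set _ | _] = (fun x => f x - fs i x) @^-1` [set 0]).
  apply: closed_comp => [x _|]; last exact: closed_eq.
  by apply: cvgB; [exact: cf|exact: cfs].
by apply/seteqP; split=> x /=; [move=> ->; rewrite subrr|move/subr0_eq].
Qed.

(** Coincidence sets are closed and the indices finitely many, so all inactive indices remain
    inactive nearby. *)
Lemma active_set_usc x : \forall z \near x, active z \subset active x.
Proof.
have : \forall z \near x, forall i, i \in active z -> i \in active x.
  apply: filter_forall => i; have [ix|ix] := boolP (i \in active x).
    exact: nearW.
  have : nbhs x (~` [set x | f x = fs i x]).
    apply: open_nbhs_nbhs; split; last by move/active_setP; exact/negP.
    by rewrite openC; exact: closed_active.
  by apply: filterS => z fz /active_setP.
by apply: filterS => z h; apply/fintype.subsetP.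
Qed.

(* Where the coincidences between the functions are frozen, [f = fs i] is a
   relatively closed condition, and so is its negation: it says that [f = fs j]
   for one of the [fs j] that differ from [fs i]. *)
Lemma active_set_constant (I : {set 'I_m}) (D : set M) :
  connected D -> (forall x, active x != finset.set0) ->
  (forall x, D x -> active x \subset I) ->
  (forall i j x y, i \in I -> j \in I -> D x -> D y ->
    fs i x = fs j x -> fs i y = fs j y) ->
  forall x y, D x -> D y -> active x = active y.
Proof.
move=> cD neA DI eqD.
suff sub x y : D x -> D y -> active x \subset active y.
  by move=> x y Dx Dy; apply/eqP; rewrite finset.eqEsubset !sub.
move=> Dx Dy; apply/fintype.subsetP => i ix.
have iI := fintype.subsetP (DI _ Dx) _ ix.
suff E : D `&` [set z | f z = fs i z] = D.
  by move: Dy; rewrite -E => -[_ /active_setP].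
apply: cD.
- by exists x; split=> //; exact/active_setP.
- exists (~` \bigcup_(j in [set j | j \in I /\ fs i x != fs j x]) 
    [set z | f z = fs j z]).
    rewrite openC; apply: closed_bigcup => [|j _]; last exact: closed_active.
    exact: finite_finset.
  apply/seteqP; split=> z [Dz fz]; split=> //.
    move=> [j [jI ij] /= jz]; move/eqP: ij; apply.
    by apply: (eqD i j z x) => //; rewrite -fz -jz.
  have /finset.set0Pn[j jz] := neA z.
  have jI := fintype.subsetP (DI _ Dz) _ jz; move/active_setP in jz.
  have [ij|ij] := eqVneq (fs i x) (fs j x); last by exfalso; apply: fz; exists j.
  by rewrite /= jz; apply/esym; exact: (eqD i j x z).
- by exists [set z | f z = fs i z] => //; exact: closed_active.
Qed.

End ActiveSets.

(** * Paths between strata and the frontier condition *)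

Section Frontier.
Context {R : realType} {n : nat} {M : smoothManifold R n} {m : nat}.
Variables (f : M -> R) (fs : 'I_m -> M -> R).
Hypothesis CSf : CS_presentation f fs.
Local Notation active := (active_set f fs).

Let cf : continuous f. Proof. by have [_ []] := CSf. Qed.

Let sfs i : smooth (fs i). Proof. by have [] := CSf. Qed.

Let cfs i : continuous (fs i). Proof. exact: smooth_continuous. Qed.

Let active_neq0 x : active x != finset.set0. Proof. by have [_ []] := CSf. Qed.

Lemma connected_unit_interval : connected (`[0, 1[%classic : set R).
Proof. by apply/(@connected_intervalP R)/interval_is_interval. Qed.

(* The differences of the functions active at [x0] shrink linearly to [0]
   along a straight path from [p] to [x], without ever changing sign before its
   endpoint. *)
Lemma active_set_path (x0 : M) :
  exists2 W, nbhs x0 W & forall p x, W p -> W x -> active x = active x0 ->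
    exists D : set M,
      [/\ connected D, D p, closure D x & forall z, D z -> active z = active p].
Proof.
have [c [cA cx0 aff]] : exists c : chart R n M, [/\ manifold_atlas c,
    chart_dom c x0 & affinely_independent (active x0)
      (fun j => gradient c (fs j) x0)] by have [_ _ _] := CSf.
(* A path kept inside [U] meets only points whose active indices lie in [I]. *)
pose I := active x0; pose V := interior [set z | active z \subset I].
pose U := [set y | chart_cod c y /\ V (chart_inv c y)].
have oU : open U.
  rewrite openE => y [cy Vy].
  have cy' : nbhs y (chart_cod c).
    by apply: open_nbhs_nbhs; split=> //; exact: chart_cod_open.
  have Vy' : nbhs (chart_inv c y) V.
    by apply: open_nbhs_nbhs; split=> //; exact: open_interior.
  exact: filterI cy' (chart_inv_continuous (mem_set cy) Vy').
have Uc : U (c x0).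
  split; first exact: chart_map_cod.
  by rewrite chart_mapK ?mem_set//; exact: active_set_usc.
have /finset.set0Pn[i0 i0I] := active_neq0 x0.
pose J := (I :\ i0)%SET.
have JI (j : 'I_#|J|) : enum_val j \in I.
  by have := enum_valP j; rewrite finset.in_setD1 => /andP[].
have Ji0 (j : 'I_#|J|) : (enum_val j == i0) = false.
  by have := enum_valP j; rewrite finset.in_setD1 => /andP[/negbTE].
pose F i := fs i \o chart_inv c.
have C1F i : Ck_on 1 U (F i).
  by apply: C1_on_subset (sfs i cA 1%N) => y [].
pose G (j : 'I_#|J|) y := F (enum_val j) y - F i0 y.
have C1G j : Ck_on 1 U (G j) by exact: C1_onB.
have dG j i : partial i (G j) (c x0) =
    gradient c (fs (enum_val j)) x0 ord0 i - gradient c (fs i0) x0 ord0 i.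
  rewrite !mxE; apply: deriveB.
    by have [_ /(_ i)[d _]] := C1F (enum_val j); apply: d; exact: mem_set.
  by have [_ /(_ i)[d _]] := C1F i0; apply: d; exact: mem_set.
have freeG (a : 'rV[R]_#|J|) :
    (forall i, \sum_j a ord0 j * partial i (G j) (c x0) = 0) -> a = 0.
  move=> aG.
  (* A linear relation between the differentials of the differences becomes an affine relation
     between the gradients once [i0] receives minus the sum of the coefficients. *)
  pose b k : R := if k == i0 then - \sum_j a ord0 j
                  else \sum_(j | enum_val j == k) a ord0 j.
  have bE j : b (enum_val j) = a ord0 j.
    rewrite /b Ji0 (big_pred1 j)// => j' /=.
    by rewrite (inj_eq enum_val_inj).
  have bi0 : b i0 = - \sum_j a ord0 j by rewrite /b eqxx.
  have sumI (W : lmodType R) (w : 'I_m -> W) : \sum_(k in I) w k =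
      w i0 + \sum_(j < #|J|) w (enum_val j).
    by rewrite (finset.big_setD1 i0)//= [in LHS]big_enum_val.
  suff b0 : {in I, forall k, b k = 0}.
    by apply/rowP => j; rewrite mxE -bE b0.
  apply: aff.
    by rewrite (sumI R^o) bi0 (eq_bigr _ (fun j _ => bE j)) addNr.
  apply/rowP => i; rewrite sumI bi0 !mxE summxE.
  rewrite -[RHS](aG i) addrC mulNr mulr_suml -sumrB.
  by apply: eq_bigr => j _; rewrite bE dG !mxE mulrBr.
have [W0 W0c path] := submersion_straight_path oU Uc C1G freeG.
exists [set z | chart_dom c z /\ W0 (c z)].
  have cx0' : nbhs x0 (chart_dom c).
    by apply: open_nbhs_nbhs; split=> //; exact: chart_dom_open.
  exact: filterI cx0' (chart_map_continuous (mem_set cx0) W0c).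
move=> p x [cp W0p] [cx W0x] xI.
have [g [cg gU g0 g1 Gg]] := path _ _ W0p W0x.
pose h := chart_inv c \o g.
have h0 : h 0 = p by rewrite /h /= g0 chart_mapK ?mem_set.
have h1 : h 1 = x by rewrite /h /= g1 chart_mapK ?mem_set.
have ch : continuous h.
  move=> s; apply: continuous_comp; first exact: cg.
  by apply: chart_inv_continuous; apply: mem_set; have [] := gU s.
(* The parameter 1 is left out: at [x] all functions of [I] coincide, so the active set may jump
   there. *)
pose D := h @` `[0, 1[.
have D0 : D p by exists 0 => //=; rewrite in_itv /= lexx ltr01.
have hI k s : k \in I -> 0 <= s <= 1 ->
    fs k (h s) - fs i0 (h s) = (1 - s) * (fs k p - fs i0 p).
  move=> kI s01; have [->|ki0] := eqVneq k i0; first by rewrite !subrr mulr0.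
  have kJ : k \in J by rewrite finset.in_setD1 ki0.
  have := Gg (enum_rank_in kJ k) s s01; rewrite /G enum_rankK_in// => Gk.
  have -> : fs k (h s) - fs i0 (h s) = F k (g s) - F i0 (g s) by [].
  (* Both functions equal [f] at [x], so the endpoint term of the interpolation vanishes. *)
  have /active_setP fk : k \in active x by rewrite xI.
  have /active_setP fi0 : i0 \in active x by rewrite xI.
  rewrite Gk /F /= !chart_mapK ?mem_set//.
  by rewrite -fk -fi0 subrr mulr0 addr0.
have cD : connected D.
  apply: connected_continuous_connected connected_unit_interval _.
  exact: continuous_subspaceT.
exists D; split=> //.
- move=> N; rewrite -h1 => /ch N1.
  have N2 : \forall s \near (1 : R)^'-,
      N (h s) /\ s \in `[0, 1[.
    near=> s; split; first by near: s; exact: cvg_at_left_filter N1.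
    rewrite in_itv /=; apply/andP; split=> //.
    by near: s; exact: nbhs_left_ge.
  have [s [Ns s01]] := @filter_ex _ _ (at_left_proper_filter 1) _ N2.
  by exists (h s); split=> //; exists s.
- move=> z Dz; apply: (active_set_constant cf cfs cD active_neq0 (I := I)) => //.
    by move=> _ [s _ <-]; have [_ /interior_subset] := gU s.
  move=> i j _ _ iI jI [s s01 <-] [t t01 <-].
  have {}s01 : 0 <= s < 1 by move: s01; rewrite /= in_itv.
  have {}t01 : 0 <= t < 1 by move: t01; rewrite /= in_itv.
  (* Differences at [h s'] are those at [p] scaled by [1 - s'], which is nonzero before the
     endpoint. *)
  have eq0 s' : 0 <= s' < 1 ->
      (fs i (h s') == fs j (h s')) = (fs i p == fs j p).
    move=> /andP[s0 s1]; have s2 : 0 <= s' <= 1 by rewrite s0 ltW.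
    rewrite -(subr_eq0 (fs i p)) -[LHS]subr_eq0.
    have -> : fs i (h s') - fs j (h s') = (1 - s') * (fs i p - fs j p).
      by have := hI i _ iI s2; have := hI j _ jI s2; lra.
    by rewrite mulf_eq0 [1 - _ == 0]subr_eq0 (gt_eqF s1).
  by move/eqP; rewrite eq0// => ij; apply/eqP; rewrite eq0.
Unshelve. all: by end_near. Qed.

Lemma closed_activity_filtration i : closed (activity_filtration f fs i).
Proof.
rewrite -openC openE => x /negP; rewrite -ltnNge => xi.
apply: filterS (active_set_usc cf cfs x) => z zx.
by apply/negP; rewrite -ltnNge (leq_ltn_trans (subset_leq_card zx)).
Qed.

(** For [0 < i <= m] no subtraction is truncated, and the two bounds [m - i + 1] and [m - i + 2] on
    the cardinal are consecutive. *)
Lemma activity_stratum i x : (0 < i <= m)%N ->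
  (activity_filtration f fs i `\` activity_filtration f fs i.-1) x <->
  #|active x| = (m - i + 1)%N.
Proof.
move=> /andP[i0 im]; rewrite /activity_filtration.
split=> [[/= h1 /negP]|/= ->]; first by rewrite -ltnNge; lia.
by split=> //; apply/negP; rewrite -ltnNge; lia.
Qed.

Lemma activity_frontier : frontier_condition m (activity_filtration f fs).
Proof.
move=> i j S S' [im [x0 Ax0 SE]] [jm [y0 Ay0 S'E]] SS'.
suff <- : S `&` closure S' = S by exact: subIsetr.
have cS : connected S by rewrite SE; exact: component_connected.
apply: cS => //; last by exists (closure S') => //; exact: closed_closure.
(* Relative openness amounts to this: near a point of [S] in the closure of [S'], every point of [S]
   is in that closure. *)
exists (interior (closure S' `|` ~` S)); first exact: open_interior.
apply/seteqP; split=> z [Sz zS']; split=> //; last first.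
  by have [] := interior_subset zS'.
have SA w : S w -> #|active w| = (m - i + 1)%N.
  by rewrite SE => /connected_component_sub /(activity_stratum _ im).
have [W zW path] := active_set_path z.
have [p [S'p Wp]] := zS' _ zW.
have := active_set_usc cf cfs z; apply: filterS2 zW => x Wx xz.
have [Sx|] := pselect (S x); [left|by right].
(* Inclusion of active sets near [z] and equal cardinals along [S] force equality. *)
have {}xz : active x = active z.
  by apply/eqP; rewrite finset.eqEcard xz !SA/=.
have [D [cD Dp Dx Dact]] := path _ _ Wp Wx xz.
(* It remains to see that [D] lies in [S']: it is connected, contains [p] and has constant active
   set. *)
apply: closure_subset Dx; rewrite S'E in S'p *.
rewrite (same_connected_component S'p).
apply: connected_component_max => // w Dw.
apply/(activity_stratum _ jm); rewrite Dact//.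
exact/(activity_stratum _ jm)/(connected_component_sub S'p).
Qed.

End Frontier.

Theorem proposition3p11 (R : realType) (n : nat) (M : smoothManifold R n)
    (m : nat) (f : M -> R) (fs : 'I_m -> M -> R) :
  CS_presentation f fs ->
  stratified_space m (activity_filtration f fs).
Proof.
move=> CSf; split; last exact: activity_frontier.
split.
- exact: manifold_hausdorff.
- by move=> i _; exact: closed_activity_filtration.
(* A point of the term of index 0 would have [m + 1] active indices among [m]. *)
- rewrite -subset0 => x; rewrite /activity_filtration /= subn0 addn1.
  by rewrite ltnNge -[in X in (_ <= X)%N](card_ord m) max_card.
- rewrite -subTset => x _; rewrite /activity_filtration /= subnn add0n.
  by rewrite finset.card_gt0; have [_ []] := CSf.
- by move=> i im x; rewrite /activity_filtration /=; apply: leq_trans; lia.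
Qed.
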